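(* Let $N$ be a normal subgroup of a finite group $G$. Then the number of real $G$-conjugacy classes of $N$ is equal to the number of real valued minimal $G$-invariant characters of $N$.
   Context: Characters are over $\mathbb{C}$. A $G$-conjugacy class of $N$ is a conjugacy class $x^G$ of $G$ with $x\in N$; it is real if $x^G=(x^{-1})^G$. $G$ acts on $\mathrm{Irr}(N)$ by $\theta^g(x)=\theta(gxg^{-1})$; the minimal $G$-invariant characters of $N$ are the characters $\widehat{\theta}$, $\theta\in\mathrm{Irr}(N)$, where $\widehat{\theta}$ is the sum of the distinct $G$-conjugates of $\theta$. A character $\vartheta$ of $N$ is real valued if $\vartheta(x)\in\mathbb{R}$ for all $x\in N$. *)

(* Defs.v *)
From mathcomp Require Import all_boot all_order all_fingroup all_algebra.
From mathcomp Require Import all_solvable all_field all_character.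

Set Implicit Arguments.
Unset Strict Implicit.
Unset Printing Implicit Defensive.

Import GroupScope Order.TTheory GRing.Theory Num.Theory.
Local Open Scope ring_scope.

(* Complex characters are MathComp's algC-valued characters: the values of a
   complex character of a finite group are algebraic numbers, and every complex
   representation is equivalent to one over algC. *)

Section RealClassesAndCharacters.

Variable gT : finGroupType.
Implicit Types G N : {group gT}.

Definition Gclasses G N : {set {set gT}} := [set x ^: G | x in N].

(* The reality condition does not depend on the representative x. *)
Definition real_Gclass G (C : {set gT}) : bool :=
  [exists x, (C == x ^: G) && (x ^: G == x^-1%g ^: G)].

(* (theta ^: G)%CF lists the distinct G-conjugates of theta; the library's
   conjugate satisfies (theta ^ g)%CF x = theta (g * x * g^-1)%g when g
   normalises N. *)
Definition cfhat G N (theta : 'CF(N)) : 'CF(N) :=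
  \sum_(xi <- (theta ^: G)%CF) xi.

(* Conjugate characters give the same sum, hence undup. *)
Definition min_inv_chars G N : seq 'CF(N) :=
  undup [seq cfhat G theta | theta <- irr N].

Definition real_valued N (phi : 'CF(N)) : bool :=
  [forall x in N, phi x \is Num.real].

End RealClassesAndCharacters.

(* Main.v *)
(* Let [f] be an involution commuting with an action of [G]. By orbit-stabiliser,
   each orbit stable under [f] contains exactly [#|G|] of the pairs [(x, a)] with
   [x^a = f x], and the other orbits contain none. Hence, for inversion on [N]
   and complex conjugation on [Irr(N)], it suffices to count such pairs.
   Multiplied by [#|N|], both counts are equal to the sum of
   [theta ^ y (x) * theta x] over [y] in [G], [x] in [N] and [theta] in [Irr(N)]:
   summing over [x] first, this is the first orthogonality relation; summing over
   [theta] first, the second one. *)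

Require Import Defs.
From mathcomp Require Import all_boot all_order all_fingroup all_algebra.
From mathcomp Require Import all_solvable all_field all_character.

Set Implicit Arguments.
Unset Strict Implicit.
Unset Printing Implicit Defensive.

Import GroupScope Order.TTheory GRing.Theory Num.Theory.
Local Open Scope ring_scope.

Section StableOrbits.

Variables (aT : finGroupType) (D : {group aT}) (rT : finType).
Variables (to : action D rT) (G : {group aT}) (f : rT -> rT).
Hypothesis sGD : G \subset D.
Hypothesis fM : {in G, forall a, {morph f : z / to z a}}.

(** Since [f] commutes with the action, [f (to x a) = to (f x) a], so a single point sent into its
    own orbit forces the whole orbit to be stable. *)
Lemma orbit_stable (x y z : rT) :
    x \in orbit to G z -> f x \in orbit to G z -> y \in orbit to G z ->
  f y \in orbit to G z.
Proof.
move=> /(orbit_in_eqP sGD)<- fx /orbitP[a Ga <-].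
by rewrite fM // orbit_actr_in.
Qed.

(** The elements of [G] moving [x] to [y] form a right coset of the stabiliser of [x]. *)
Lemma card_amove_orbit (x y : rT) :
  y \in orbit to G x -> (#|orbit to G x| * #|amove to G x y|)%N = #|G|.
Proof.
case/orbitP=> a Ga <-; rewrite amove_act // card_rcoset.
exact: card_orbit_in_stab.
Qed.

Lemma card_stable_orbits (S : {set rT}) :
    [acts G, on S | to] ->
  (#|[set O in orbit to G @: S | [exists x in O, f x \in O]]| * #|G|)%N
    = (\sum_(x in S) #|amove to G x (f x)|)%N.
Proof.
move=> GactS; rewrite (set_partition_big _ (orbit_partition GactS)) /=.
rewrite -sum_nat_const big_mkcond [RHS]big_mkcond /=; apply: eq_bigr => O _.
rewrite inE; case: imsetP => //= -[x0 _ ->{O}].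
case: exists_inP => [[x x0x fx] | notf]; last first.
  rewrite big1 // => x x0x; apply/eqP; rewrite cards_eq0; apply/eqP/setP=> a.
  rewrite !inE; apply/andP=> -[Ga /eqP xaf]; case: notf; exists x => //.
  by rewrite -xaf orbit_actr_in.
have O_gt0: (0 < #|orbit to G x0|)%N by rewrite (cardD1 x0) orbit_refl.
(* Spread [#|G|] over the orbit as copies of the stabiliser order of [x0]; each copy matches its
   summand because both become [#|G|] when multiplied by the orbit length. *)
rewrite -(card_orbit_in_stab to x0 sGD) -sum_nat_const.
apply: eq_bigr => y x0y; apply/eqP; rewrite -(eqn_pmul2l O_gt0).
have fy := orbit_stable x0x fx x0y; rewrite card_orbit_in_stab //.
by move: fy; have /(orbit_in_eqP sGD)<- := x0y => /card_amove_orbit->.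
Qed.

End StableOrbits.

Section IrrAction.

Variables (gT : finGroupType) (G N : {group gT}).
Hypothesis nsNG : N <| G.

Fact conjg_Iirr_is_action : is_action G (@conjg_Iirr gT N).
Proof.
split=> [y i j /conjg_Iirr_inj // | i y z Gy Gz].
by apply: irr_inj; rewrite !conjg_IirrE (cfConjgM _ nsNG).
Qed.

Definition Iirr_action := Action conjg_Iirr_is_action.

Lemma conjC_conjg_Iirr (i : Iirr N) y :
  conjC_Iirr (conjg_Iirr i y) = conjg_Iirr (conjC_Iirr i) y.
Proof.
by apply: irr_inj; rewrite !(conjC_IirrE, conjg_IirrE) conj_cfConjg.
Qed.

(** Second orthogonality at [x ^ y^-1] and [x^-1]: the sum is a centraliser order if these are
    conjugate in [N], and 0 otherwise. *)
Lemma sum_irr_conjg (x y : gT) : x \in N -> y \in G ->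
  \sum_i ('chi[N]_i ^ y)%CF x * 'chi_i x = #|amove 'J N (x ^ y^-1) x^-1|%:R.
Proof.
move=> Nx Gy; have nNy := subsetP (normal_norm nsNG) y Gy.
have NxV: x^-1%g \in N by rewrite groupV.
transitivity (\sum_i 'chi[N]_i (x ^ y^-1)%g * ('chi_i x^-1%g)^*).
  by apply: eq_bigr => i _; rewrite cfConjgE // irr_inv conjCK.
rewrite second_orthogonality_relation // class_sym.
case: imsetP => [[n Nn ->] | notJ].
  rewrite -[(_ ^ n)%g]/('J%act _ n) amove_act ?subsetT // card_rcoset.
  by rewrite astab1J.
apply/esym/eqP; rewrite pnatr_eq0 cards_eq0; apply/eqP/setP=> n.
by rewrite !inE; apply/andP=> -[Nn /eqP nJ]; case: notJ; exists n.
Qed.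

Lemma sum_amove_coset (x : gT) :
  (\sum_(y in G) #|amove 'J N (x ^ y^-1) x^-1|)%N
     = (#|N| * #|amove 'J G x x^-1|)%N.
Proof.
have sNG := subsetP (normal_sub nsNG).
transitivity (\sum_(y in G) \sum_(n in N) (x ^ (y^-1 * n) == x^-1)%g)%N.
  apply: eq_bigr => y _; rewrite -sum1_card big_mkcond [RHS]big_mkcond.
  apply: eq_bigr => n _; rewrite inE /= -conjgM.
  by case: (n \in N); case: eqP.
rewrite exchange_big -sum_nat_const; apply: eq_bigr => n Nn.
(* For fixed [n], replacing [y] by [(y * n^-1)^-1] turns [y^-1 * n] into [y], so each [n]
   contributes the same count. *)
rewrite (reindex_inj invg_inj) (reindex_inj (mulIg n^-1%g)) /=.
rewrite -sum1_card big_mkcond [RHS]big_mkcond; apply: eq_bigr => y _.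
rewrite invgK mulgKV groupV groupMr ?groupV ?(sNG n Nn) // inE /=.
by case: (y \in G); case: eqP.
Qed.

Lemma sum_amove_irr :
  (\sum_i #|amove Iirr_action G i (conjC_Iirr i)|)%N
    = (\sum_(x in N) #|amove 'J G x x^-1|)%N.
Proof.
apply/eqP; rewrite -(eqr_nat algC) -(inj_eq (mulfI (neq0CG N))); apply/eqP.
transitivity
  (\sum_(y in G) \sum_(x in N) \sum_i ('chi[N]_i ^ y)%CF x * 'chi_i x).
  rewrite natr_sum mulr_sumr.
  under [RHS]eq_bigr => y _ do rewrite exchange_big.
  rewrite [RHS]exchange_big; apply: eq_bigr => i _.
  rewrite -[#|amove _ _ _ _|]sum1_card natr_sum mulr_sumr.
  rewrite big_mkcond [RHS]big_mkcond /=.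
  apply: eq_bigr => y _; rewrite inE; case: (y \in G) => //=.
  (* The conjugation in the inner product cancels the one in [conjC_Iirr], leaving the bilinear sum
     over [x]. *)
  transitivity (#|N|%:R * '['chi_(conjg_Iirr i y), 'chi_(conjC_Iirr i)]).
    by rewrite cfdot_irr; case: eqP; rewrite ?mulr0.
  rewrite cfdotE mulVKf ?neq0CG //; apply: eq_bigr => x _.
  by rewrite conjg_IirrE conjC_IirrE cfConjCE conjCK.
rewrite exchange_big /= natr_sum mulr_sumr; apply: eq_bigr => x Nx.
rewrite -natrM -sum_amove_coset natr_sum; apply: eq_bigr => y Gy.
exact: sum_irr_conjg.
Qed.

Definition sum_irr (O : {set Iirr N}) : 'CF(N) := \sum_(i in O) 'chi_i.

Lemma cfdot_sum_irr_set O i : '[sum_irr O, 'chi_i] = (i \in O)%:R.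
Proof.
rewrite cfdot_suml big_mkcond (bigD1 i) //= cfdot_irr eqxx big1 ?addr0.
  by case: (i \in O).
by move=> j ne_ji; rewrite cfdot_irr (negPf ne_ji) if_same.
Qed.

(** Inner products with the irreducible characters recover the index set. *)
Lemma sum_irr_inj : injective sum_irr.
Proof.
move=> O1 O2 eqO; apply/setP=> i; have /eqP := cfdot_sum_irr_set O1 i.
by rewrite eqO cfdot_sum_irr_set eqr_nat; do 2!case: (i \in _).
Qed.

Lemma cfhat_irr i : cfhat G 'chi[N]_i = sum_irr (orbit Iirr_action G i).
Proof.
rewrite /cfhat reindex_cfclass //.
by apply: eq_bigl => j; rewrite -cfclass_IirrE.
Qed.

Lemma real_valuedE (phi : 'CF(N)) : real_valued phi = (phi^*%CF == phi).
Proof.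
apply/forall_inP/eqP=> [phiR | phiR x Nx].
  by apply/cfun_inP=> x Nx; rewrite cfConjCE; apply/CrealP/phiR.
by apply/CrealP; rewrite -cfConjCE phiR.
Qed.

Lemma conjC_sum_irr O : (sum_irr O)^*%CF = sum_irr (@conjC_Iirr _ N @^-1: O).
Proof.
rewrite rmorph_sum /= [RHS](reindex_inj (can_inj conjC_IirrK)) /=.
by apply: eq_big => i; rewrite ?inE ?conjC_IirrK // conjC_IirrE.
Qed.

Lemma real_valued_orbit i (O := orbit Iirr_action G i) :
  real_valued (sum_irr O) = [exists j in O, conjC_Iirr j \in O].
Proof.
rewrite real_valuedE conjC_sum_irr (inj_eq sum_irr_inj).
apply/eqP/exists_inP=> [defO | [j Oj Ocj]].
  exists i; first exact: orbit_refl.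
  by have /setP/(_ i) := defO; rewrite inE orbit_refl => ->.
have fM: {in G, forall a, {morph @conjC_Iirr _ N : z / Iirr_action z a}}.
  by move=> a _ k; apply: conjC_conjg_Iirr.
have stabO := orbit_stable (subxx G) fM Oj Ocj.
(* Stability gives one inclusion; the other follows as conjugation is an involution. *)
apply/setP=> k; rewrite inE; apply/idP/idP; last exact: stabO.
by move/stabO; rewrite conjC_IirrK.
Qed.

End IrrAction.

Theorem corollary5p4 (gT : finGroupType) (G N : {group gT}) (nsNG : normal N G) :
  #|[set C in Gclasses G N | real_Gclass G C]|
  = size [seq phi <- min_inv_chars G N | real_valued phi].
Proof.
pose to := Iirr_action nsNG.
(* The factor [#|G|] turns both sides into counts of pairs. *)
apply/eqP; rewrite -(eqn_pmul2r (cardG_gt0 G)); apply/eqP.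
transitivity (\sum_(x in N) #|amove 'J G x x^-1|)%N.
  rewrite -(card_stable_orbits (to := 'J%act) (f := invg) (subsetT G)); first 1 last.
  - by move=> a _ x; rewrite /= conjVg.
  - by rewrite astabsJ normal_norm.
  congr (_ * _)%N; apply: eq_card => C; rewrite !inE.
  apply: andb_id2l => /imsetP[x0 _ ->{C}].
  apply/existsP/exists_inP=> [[x /andP[/eqP-> /eqP xV]] | [x x0x x0xV]].
    by exists x; rewrite ?class_refl // xV class_refl.
  by exists x; rewrite (class_eqP x0xV) (class_eqP x0x) eqxx.
rewrite -(sum_amove_irr nsNG) -/to.
have <-: (#|[set O in orbit to G @: [set: Iirr N] |
              [exists i in O, conjC_Iirr i \in O]]| * #|G|)%N
     = (\sum_i #|amove to G i (conjC_Iirr i)|)%N.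
  rewrite card_stable_orbits ?subxx //; first by apply: eq_bigl => i; rewrite inE.
  - by move=> a _ i; apply: conjC_conjg_Iirr.
  by apply/subsetP=> a Ga; rewrite !inE Ga; apply/subsetP=> i _; rewrite !inE.
(* [sum_irr] carries the stable orbits bijectively to the real valued minimal invariant characters:
   both lists are duplicate-free with the same members. *)
congr (_ * _)%N; rewrite cardE -(size_map (@sum_irr gT N)).
apply/perm_size/uniq_perm.
- by rewrite map_inj_uniq ?enum_uniq //; apply: sum_irr_inj.
- by rewrite filter_uniq ?undup_uniq.
move=> phi; rewrite mem_filter mem_undup.
apply/mapP/andP=> [[O] | [phiR /mapP[theta /irrP[i ->] def_phi]]].
  rewrite mem_enum inE => /andP[/imsetP[i _ ->] Oreal] ->.
  rewrite (real_valued_orbit nsNG) -cfhat_irr map_f ?mem_irr //.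
exists (orbit to G i); last by rewrite def_phi (cfhat_irr nsNG).
rewrite mem_enum inE imset_f ?inE //=.
by rewrite -(real_valued_orbit nsNG) -cfhat_irr -def_phi.
Qed.
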